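(* Let $(M,P,S)$ and $(L,R,T)$ be perfect structures, where $M$ (order $n_1$) and $L$ (order $n_2$) are the adjacency matrices of graphs $G$ and $H$, $S$ has order $k_1$ and $T$ has order $k_2$. Then $P\otimes R$ is a perfect structure in the normal product $G\boxtimes H$, whose adjacency matrix is $M\otimes I_{n_2}+I_{n_1}\otimes L+M\otimes L$, with parameter matrix $I_{k_1}\otimes T+S\otimes I_{k_2}+S\otimes T$.
   Context: A perfect structure is a triple $(M,P,S)$ of complex matrices with $MP=PS$, where $M$ is a diagonalizable square matrix of order $n$, $P$ is an $n\times k$ matrix with $k\le n$, and $S$ is a $k\times k$ matrix. $\otimes$ is the Kronecker product and $I_r$ the identity matrix of order $r$. *)

(* Defs.v *)
(* Complex numbers are R[i] for R : realType. *)
From HB Require Import structures.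
From mathcomp Require Import all_boot all_order all_fingroup all_algebra.
From mathcomp Require Import character.
From mathcomp Require Import reals complex.

Set Implicit Arguments.
Unset Strict Implicit.
Unset Printing Implicit Defensive.

Import GRing.Theory.
Local Open Scope ring_scope.

(* The library's tensor product is the Kronecker product: the block of
   tprod A B at position (i, j) is A i j *: B; see tprod_lexE below. *)
Notation "A ⊗ B" := (tprod A B)
  (at level 40, left associativity) : ring_scope.

(* k : 'I_(m * n) stands for the pair (k %/ n, k %% n), which enumerates
   'I_m * 'I_n lexicographically. *)
Section LexPair.

Variables m n : nat.

Lemma lex_fst_subproof (k : 'I_(m * n)) : (k %/ n < m)%N.
Proof. by case: n k => [|p] [k /=]; rewrite ?muln0 // ltn_divLR. Qed.

Lemma lex_snd_subproof (k : 'I_(m * n)) : (k %% n < n)%N.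
Proof. by case: n k => [|p] [k /=]; rewrite ?muln0 // ltn_mod. Qed.

Definition lex_fst (k : 'I_(m * n)) : 'I_m := Ordinal (lex_fst_subproof k).
Definition lex_snd (k : 'I_(m * n)) : 'I_n := Ordinal (lex_snd_subproof k).

End LexPair.

Lemma tprod_lexE (F : fieldType) m1 n1 m2 n2
    (A : 'M[F]_(m1, n1)) (B : 'M[F]_(m2, n2)) i j :
  (A ⊗ B) i j = A (lex_fst i) (lex_fst j) * B (lex_snd i) (lex_snd j).
Proof.
have trowE (n : nat) : forall (a : 'rV[F]_n) (k : 'I_m2) (l : 'I_(n * n2)),
    trow a B k l = a 0 (lex_fst l) * B k (lex_snd l).
  elim: n => [|n IHn] a k l; first by case: l.
  rewrite /= mxE; case: (@splitP n2 (n * n2) l) => l' Dl.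
    rewrite !mxE; congr (a _ _ * B _ _); apply: val_inj => /=;
    by rewrite ?Dl ?divn_small ?modn_small.
  have n2_gt0 : (0 < n2)%N by case: (n2) l' {Dl} => // -[l' /=]; rewrite muln0.
  rewrite IHn !mxE; congr (a _ _ * B _ _); apply: val_inj => /=.
    by rewrite Dl /bump /= divnDl ?dvdnn // divnn n2_gt0.
  by rewrite Dl modnDl.
elim: m1 A i => [|m1 IHm] A i; first by case: i.
rewrite /= mxE; case: (@splitP m2 (m1 * m2) i) => i' Di.
  rewrite trowE !mxE; congr (A _ _ * B _ _); apply: val_inj => /=;
  by rewrite ?Di ?divn_small ?modn_small.
have m2_gt0 : (0 < m2)%N by case: (m2) i' {Di} => // -[i' /=]; rewrite muln0.
rewrite IHm !mxE; congr (A _ _ * B _ _); apply: val_inj => /=.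
  by rewrite Di /bump /= divnDl ?dvdnn // divnn m2_gt0.
by rewrite Di modnDl.
Qed.

(* Symmetry of the edge relation is not required, so that
   both undirected and directed simple graphs are covered. *)
Record graph (V : finType) := Graph {
  edge :> rel V;
  edge_irrefl : irreflexive edge
}.

Section NormalProduct.

Variables (V W : finType) (G : graph V) (H : graph W).

Definition normal_edge : rel (V * W) := fun x y =>
  [|| (x.1 == y.1) && H x.2 y.2,
      G x.1 y.1 && (x.2 == y.2) |
      G x.1 y.1 && H x.2 y.2].

Lemma normal_edge_irrefl : irreflexive normal_edge.
Proof. by move=> x; rewrite /normal_edge !edge_irrefl !andbF. Qed.

Definition normal_product : graph (V * W)%type := Graph normal_edge_irrefl.

Lemma normal_product_sym :
  symmetric G -> symmetric H -> symmetric normal_product.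
Proof.
move=> symG symH x y; rewrite /= /normal_edge (symG x.1) (symH x.2).
by rewrite (eq_sym x.1) (eq_sym x.2).
Qed.

(* The order on pairs that matches the row order of the Kronecker product. *)
Definition lex_order n1 n2 (f : 'I_n1 -> V) (h : 'I_n2 -> W) :
  'I_(n1 * n2) -> V * W := fun k => (f (lex_fst k), h (lex_snd k)).

End NormalProduct.

Notation "G ⊠ H" := (normal_product G H) (at level 40, left associativity).

(* M is the adjacency matrix of G for the ordering f of its vertices. *)
Definition adjacency_matrix (C : fieldType) (V : finType) (G : graph V) n
    (f : 'I_n -> V) (M : 'M[C]_n) : Prop :=
  bijective f /\ M = \matrix_(i, j) (G (f i) (f j))%:R.

Definition perfect_structure (C : fieldType) n k
    (M : 'M[C]_n) (P : 'M[C]_(n, k)) (S : 'M[C]_k) : Prop :=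
  [/\ diagonalizable M, (k <= n)%N & M *m P = P *m S].

(* Main.v *)
Require Import Defs.
From HB Require Import structures.
From mathcomp Require Import all_boot all_order all_fingroup all_algebra.
From mathcomp Require Import character.
From mathcomp Require Import reals complex.

Set Implicit Arguments.
Unset Strict Implicit.
Unset Printing Implicit Defensive.

Import GRing.Theory.
Local Open Scope ring_scope.

(* The mixed-product rule (A ⊗ B)(X ⊗ Y) = AX ⊗ BY turns AX = XA', BY = YB' into
   the corresponding identity for the matrices of the normal product. This
   yields both the equation of the perfect structure and, applied to matrices
   of eigenvectors, the diagonalizability. *)

Lemma inj_lex_pair m n :
  injective (fun k : 'I_(m * n) => (lex_fst k, lex_snd k)).
Proof.
move=> k l [eq_div eq_mod]; apply: val_inj.
by rewrite /= (divn_eq k n) (divn_eq l n) eq_div eq_mod.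
Qed.

(** Source and target have equal cardinality, so injectivity suffices and no inverse is built. *)
Lemma bij_lex_order (V W : finType) n1 n2 (f : 'I_n1 -> V) (h : 'I_n2 -> W) :
  bijective f -> bijective h -> bijective (lex_order f h).
Proof.
move=> bij_f bij_h; apply: inj_card_bij.
  move=> k l [/(bij_inj bij_f) eq1 /(bij_inj bij_h) eq2].
  by apply: inj_lex_pair; rewrite /= eq1 eq2.
by rewrite card_prod -(bij_eq_card bij_f) -(bij_eq_card bij_h) !card_ord.
Qed.

Section Kronecker.

Variable F : fieldType.

(** Distinct indices differ in quotient or remainder, so one factor of each off-diagonal entry
    vanishes. *)
Lemma tprod_is_diag_mx m n (A : 'M[F]_m) (B : 'M[F]_n) :
  is_diag_mx A -> is_diag_mx B -> is_diag_mx (A ⊗ B).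
Proof.
move=> /is_diag_mxP diagA /is_diag_mxP diagB; apply/is_diag_mxP => i j.
have [/eqP eq1 | neq1 _] := boolP (lex_fst i == lex_fst j); last first.
  by rewrite tprod_lexE diagA ?mul0r.
have [/eqP eq2 | neq2 _] := boolP (lex_snd i == lex_snd j); last first.
  by rewrite tprod_lexE diagB ?mulr0.
by rewrite (@inj_lex_pair _ _ i j) ?eqxx //= eq1 eq2.
Qed.

(** By the mixed-product rule, [invmx A ⊗ invmx B] is an inverse. *)
Lemma tprod_unitmx m n (A : 'M[F]_m) (B : 'M[F]_n) :
  A \in unitmx -> B \in unitmx -> A ⊗ B \in unitmx.
Proof.
move=> uA uB.
suff /mulmx1_unit[] : (A ⊗ B) *m (invmx A ⊗ invmx B) = 1%:M by [].
by rewrite -tprodE !mulmxV // tprod1.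
Qed.

(** This is (A + I) ⊗ (B + I) - I. The same shape serves for the adjacency matrix, the parameter
    matrix and the diagonal form. *)
Definition normal_mx m n (A : 'M[F]_m) (B : 'M[F]_n) : 'M[F]_(m * n) :=
  A ⊗ 1%:M + 1%:M ⊗ B + A ⊗ B.

Lemma normal_mx_intertwine m n p q
    (A : 'M[F]_m) (X : 'M[F]_(m, p)) (A' : 'M[F]_p)
    (B : 'M[F]_n) (Y : 'M[F]_(n, q)) (B' : 'M[F]_q) :
  A *m X = X *m A' -> B *m Y = Y *m B' ->
  normal_mx A B *m (X ⊗ Y) = (X ⊗ Y) *m normal_mx A' B'.
Proof.
move=> AX BY; rewrite /normal_mx !mulmxDl !mulmxDr -!tprodE.
by rewrite !mul1mx !mulmx1 AX BY.
Qed.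

Lemma normal_mx_is_diag m n (A : 'M[F]_m) (B : 'M[F]_n) :
  is_diag_mx A -> is_diag_mx B -> is_diag_mx (normal_mx A B).
Proof.
move=> diagA diagB.
have diag1 k : is_diag_mx (1%:M : 'M[F]_k) by apply: scalar_mx_is_diag.
have /is_diag_mxP d1 := tprod_is_diag_mx diagA (diag1 n).
have /is_diag_mxP d2 := tprod_is_diag_mx (diag1 m) diagB.
have /is_diag_mxP d3 := tprod_is_diag_mx diagA diagB.
by apply/is_diag_mxP => i j neq_ij;
  rewrite /normal_mx !mxE d1 // d2 // d3 // !addr0.
Qed.

Lemma normal_mx_diagonalizable m n (A : 'M[F]_m) (B : 'M[F]_n) :
  diagonalizable A -> diagonalizable B -> diagonalizable (normal_mx A B).
Proof.
move=> [X uX /similar_diagPex[a /(similarP uX) XA]].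
move=> [Y uY /similar_diagPex[b /(similarP uY) YB]].
have uXY := tprod_unitmx uX uY.
exists (X ⊗ Y) => //; rewrite /similar_to.
have /eqP-> : similar (X ⊗ Y) (normal_mx A B)
    (normal_mx (diag_mx a) (diag_mx b)).
  (* Similarity via [X] reads [X *m A = diag_mx a *m X]: the rows of [X] are left eigenvectors.
     Reversed, it is an intertwining with the diagonal matrix on the left. *)
  by apply/(similarP uXY)/esym/normal_mx_intertwine.
by apply: normal_mx_is_diag; apply: diag_mx_is_diag.
Qed.

Lemma normal_product_adjacency (V W : finType) (G : graph V) (H : graph W)
    n1 n2 (f : 'I_n1 -> V) (h : 'I_n2 -> W) (M : 'M[F]_n1) (L : 'M[F]_n2) :
  adjacency_matrix G f M -> adjacency_matrix H h L ->
  adjacency_matrix (G ⊠ H) (lex_order f h) (normal_mx M L).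
Proof.
move=> [bij_f ->] [bij_h ->]; split; first exact: bij_lex_order.
apply/matrixP => i j; rewrite /normal_mx [LHS]mxE [X in X + _]mxE.
(* Injectivity of [f] and [h] turns the vertex equalities of [normal_edge] into index equalities,
   matching the entries of the identity factors. *)
rewrite !tprod_lexE !mxE /= /normal_edge /= (inj_eq (bij_inj bij_f)) (inj_eq (bij_inj bij_h)).
(* Irreflexivity makes the three disjuncts of normal_edge exclusive. *)
case: eqP => [->|_]; case: eqP => [->|_]; rewrite ?edge_irrefl;
by do ?case: (edge _ _ _); rewrite /= ?(mulr0, mul0r, mulr1, addr0, add0r).
Qed.

End Kronecker.

Theorem theorem4 (R : realType) (V W : finType) (G : graph V) (H : graph W)
    (n1 n2 k1 k2 : nat) (f : 'I_n1 -> V) (h : 'I_n2 -> W)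
    (M : 'M[R[i]]_n1) (P : 'M[R[i]]_(n1, k1)) (S : 'M[R[i]]_k1)
    (L : 'M[R[i]]_n2) (Q : 'M[R[i]]_(n2, k2)) (T : 'M[R[i]]_k2)
    (adjG : adjacency_matrix G f M) (adjH : adjacency_matrix H h L)
    (perfG : perfect_structure M P S) (perfH : perfect_structure L Q T) :
  let N := M ⊗ (1%:M : 'M_n2) + (1%:M : 'M_n1) ⊗ L + M ⊗ L in
  adjacency_matrix (G ⊠ H) (lex_order f h) N /\
  perfect_structure N (P ⊗ Q)
    ((1%:M : 'M_k1) ⊗ T + S ⊗ (1%:M : 'M_k2) + S ⊗ T).
Proof.
have [diagM le_k1 MP] := perfG; have [diagL le_k2 LQ] := perfH.
split; first exact: normal_product_adjacency.
split; first exact: normal_mx_diagonalizable.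
  exact: leq_mul.
(* The parameter matrix lists its first two summands in the opposite order to [normal_mx]. *)
by rewrite (addrC (1%:M ⊗ T)); apply: normal_mx_intertwine.
Qed.
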